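(* Let $K$ be a field. Any $(12)$-matching structure on $UT_3(K)$ is isomorphic to exactly one of the following structures (where $\alpha,\beta,\gamma$ are parameters in $K$, and products of basis elements that are not listed are zero): (1) $e_{12}\star e_{12}=e_{12}$, $e_{12}\star e_{23}=e_{23}$; (2) $e_{12}\star e_{23}=e_{12}$, $e_{23}\star e_{23}=e_{23}$; (3) $e_{12}\star e_{12}=\alpha e_{13}$, $e_{12}\star e_{23}=\beta e_{13}$, $e_{23}\star e_{12}=\gamma e_{13}$, $e_{23}\star e_{23}=e_{13}$; (4) $e_{12}\star e_{12}=e_{13}$, $e_{12}\star e_{23}=\alpha e_{13}$, $e_{23}\star e_{12}=\beta e_{13}$; (5) $e_{12}\star e_{23}=\alpha e_{13}$, $e_{23}\star e_{12}=\beta e_{13}$.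
   Context: $K$ is an arbitrary field; all products are $K$-bilinear. $UT_3(K)$ is the associative algebra of strictly upper triangular $3\times 3$ matrices over $K$ with the usual matrix product $\cdot$; it has $K$-basis $e_{12},e_{23},e_{13}$ of matrix units, and the only nonzero product of basis elements is $e_{12}\cdot e_{23}=e_{13}$. A $(12)$-matching structure on an associative algebra $(A,\cdot)$ is an associative bilinear product $*$ on $A$ such that $(a\cdot b)*c=a*(b\cdot c)$ and $(a*b)\cdot c=a\cdot(b*c)$ for all $a,b,c\in A$. Two such structures $*_1$ and $*_2$ on $(A,\cdot)$ are isomorphic if there is an algebra automorphism $\phi$ of $(A,\cdot)$ with $\phi(a*_1b)=\phi(a)*_2\phi(b)$ for all $a,b\in A$. In the families, different values of the parameters count as different structures. *)

(* Defs.v *)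
From HB Require Import structures.
From mathcomp Require Import all_boot all_order all_algebra.
Set Implicit Arguments.
Unset Strict Implicit.
Unset Printing Implicit Defensive.
Import GRing.Theory.
Local Open Scope ring_scope.

Section MatchingStructures.
Variables (K : fieldType) (A : lmodType K).
Implicit Types (dot star : A -> A -> A).

Definition bilinear_op star : Prop :=
  (forall b, linear (fun a => star a b)) /\ (forall a, linear (star a)).

Definition assoc_algebra_product dot : Prop :=
  bilinear_op dot /\ associative dot.

Record matching12_structure dot star : Prop := Matching12Structure {
  matching12_product : assoc_algebra_product star;
  matching12_dot_star :
    forall a b c, star (dot a b) c = star a (dot b c);
  matching12_star_dot :
    forall a b c, dot (star a b) c = dot a (star b c)
}.

Definition algebra_automorphism dot (phi : {linear A -> A}) : Prop :=
  bijective phi /\ {morph phi : a b / dot a b}.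

Definition matching12_isomorphic dot star1 star2 : Prop :=
  exists2 phi : {linear A -> A}, algebra_automorphism dot phi &
    forall a b, phi (star1 a b) = star2 (phi a) (phi b).

End MatchingStructures.

Section StrictUpperTriangular.
Variable K : fieldType.

Definition strict_upper : {pred 'M[K]_3} :=
  fun M => [forall i : 'I_3, forall j : 'I_3, (j <= i)%N ==> (M i j == 0)].

Lemma strict_upperP (M : 'M[K]_3) :
  reflect (forall i j : 'I_3, (j <= i)%N -> M i j = 0) (M \in strict_upper).
Proof.
apply: (iffP forallP) => [H i j le_ji | H i].
  by have /forallP/(_ j)/implyP/(_ le_ji)/eqP := H i.
by apply/forallP => j; apply/implyP => /H ->.
Qed.

Fact strict_upper_submod_closed : submod_closed strict_upper.
Proof.
split=> [|a M N /strict_upperP HM /strict_upperP HN].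
  by apply/strict_upperP => i j _; rewrite mxE.
by apply/strict_upperP => i j ji; rewrite !mxE HM // HN // mulr0 addr0.
Qed.

HB.instance Definition _ :=
  GRing.isSubmodClosed.Build K 'M[K]_3 strict_upper strict_upper_submod_closed.

Record UT3 := MkUT3 { UT3_val :> 'M[K]_3; _ : UT3_val \in strict_upper }.

HB.instance Definition _ := [isSub for UT3_val].
HB.instance Definition _ := [Choice of UT3 by <:].
HB.instance Definition _ := [SubChoice_isSubLmodule of UT3 by <:].

Fact mulmx_strict_upper (x y : UT3) : x *m y \in strict_upper.
Proof.
case: x y => [M /= /strict_upperP HM] [N /= /strict_upperP HN].
apply/strict_upperP => i j le_ji; rewrite mxE big1 // => k _.
have [le_ki|lt_ik] := leqP k i; first by rewrite HM // mul0r.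
by rewrite HN ?mulr0 // (leq_trans le_ji) // ltnW.
Qed.

Definition UT3_mul (x y : UT3) : UT3 := MkUT3 (mulmx_strict_upper x y).

Lemma UT3_mul_assoc_algebra : assoc_algebra_product UT3_mul.
Proof.
split; last by move=> x y z; apply: val_inj; rewrite /= mulmxA.
split=> [y a u v|x a u v]; apply: val_inj => /=.
  by rewrite mulmxDl -scalemxAl.
by rewrite mulmxDr -scalemxAr.
Qed.

Fact delta_strict_upper (i j : 'I_3) :
  (i < j)%N -> delta_mx i j \in strict_upper.
Proof.
move=> lt_ij; apply/strict_upperP => k l; rewrite mxE.
have [-> | //] := eqVneq k i; have [-> | //] := eqVneq l j.
by rewrite leqNgt lt_ij.
Qed.

(* Rows and columns are numbered from 0 here, so e12 is the unit at (0, 1). *)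
Definition e12 : UT3 := MkUT3 (@delta_strict_upper 0 1 isT).
Definition e23 : UT3 := MkUT3 (@delta_strict_upper 1 2 isT).
Definition e13 : UT3 := MkUT3 (@delta_strict_upper 0 2 isT).

Variant basis_index := I12 | I23 | I13.

Definition basis_elt (s : basis_index) : UT3 :=
  match s with I12 => e12 | I23 => e23 | I13 => e13 end.

Definition basis_coord (s : basis_index) (x : UT3) : K :=
  match s with
  | I12 => UT3_val x 0 1
  | I23 => UT3_val x 1 2
  | I13 => UT3_val x 0 2
  end.

Definition table_product (T : basis_index -> basis_index -> UT3)
    (x y : UT3) : UT3 :=
  \sum_(s <- [:: I12; I23; I13]) \sum_(t <- [:: I12; I23; I13])
    (basis_coord s x * basis_coord t y) *: T s t.

Variant UT3_family :=
  | Fam1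
  | Fam2
  | Fam3 of K & K & K
  | Fam4 of K & K
  | Fam5 of K & K.

Definition family_table (f : UT3_family) (s t : basis_index) : UT3 :=
  match f, s, t with
  | Fam1, I12, I12 => e12
  | Fam1, I12, I23 => e23
  | Fam2, I12, I23 => e12
  | Fam2, I23, I23 => e23
  | Fam3 alpha _ _, I12, I12 => alpha *: e13
  | Fam3 _ beta _, I12, I23 => beta *: e13
  | Fam3 _ _ gamma, I23, I12 => gamma *: e13
  | Fam3 _ _ _, I23, I23 => e13
  | Fam4 _ _, I12, I12 => e13
  | Fam4 alpha _, I12, I23 => alpha *: e13
  | Fam4 _ beta, I23, I12 => beta *: e13
  | Fam5 alpha _, I12, I23 => alpha *: e13
  | Fam5 _ beta, I23, I12 => beta *: e13
  | _, _, _ => 0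
  end.

Definition family_star (f : UT3_family) : UT3 -> UT3 -> UT3 :=
  table_product (family_table f).

Lemma basis_coordE (s t : basis_index) :
  basis_coord s (basis_elt t) =
  match s, t with I12, I12 | I23, I23 | I13, I13 => 1 | _, _ => 0 end.
Proof.
by case: s; case: t; rewrite /= mxE.
Qed.

Lemma table_product_basis (T : basis_index -> basis_index -> UT3) s t :
  table_product T (basis_elt s) (basis_elt t) = T s t.
Proof.
by rewrite /table_product !big_cons !big_nil !basis_coordE;
  case: s; case: t; rewrite ?(mulr0, mul0r, mulr1, scale0r, scale1r, addr0, add0r).
Qed.

End StrictUpperTriangular.

(* Main.v *)
Require Import Defs.
From HB Require Import structures.
From mathcomp Require Import all_boot all_order all_algebra.
From mathcomp Require Import ring.

Set Implicit Arguments.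
Unset Strict Implicit.
Unset Printing Implicit Defensive.
Import GRing.Theory.
Local Open Scope ring_scope.

(** Write [x = e12], [y = e23], [z = e13], and [X], [Y], [Z] for the coordinates
    in this basis. The only nonzero product is [x . y = z], so that
    [u . v = X u * Y v * z].

    The mixed laws leave little freedom. From [(u . v) * w = u * (v . w)]
    the element [z] annihilates everything for [*], because [y . w = 0] and
    [w . x = 0] ([star_e13]). From [(u * v) . w = u . (v * w)], that is
    [X (u * v) * Y w = X u * Y (v * w)], there is one linear form
    [lambda = p X + q Y] with [X (u * v) = X u * lambda v] and
    [Y (u * v) = lambda u * Y v]. Hence a matching structure is given by [p], [q]
    and the four coefficients of the bilinear form [Z (u * v)] in [X] and [Y]
    ([star_std]), and associativity of [*] amounts to five monomial equations
    on these six scalars ([compatible]).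

    The automorphisms are the maps [x |-> a x + s z], [y |-> d y + t z],
    [z |-> a d z] with [a] and [d] nonzero ([automorphism_diag_map]), so an
    isomorphism is a solution of six equations in [a], [d], [s], [t]
    ([isomorphic_std]). If [p] is nonzero, then [q = 0] and the products [y * x]
    and [y * y] vanish; [s] and [t] remove the components of [x * x] and [x * y]
    along [z], and [a] scales [p] to 1, which is family (1). The case of nonzero
    [q] is its mirror image, family (2). If [p = q = 0], only the scaling by [a]
    and [d] matters: it multiplies the coefficients of [x * x] and [y * y] by
    reciprocal factors and fixes those of [x * y] and [y * x]. The latter two,
    the product of the former two, and the vanishing of each are then a complete
    set of invariants, which separates families (3), (4) and (5).

    Consequently the family member is an explicit function of the six scalars
    ([normal_form]): every structure is isomorphic to it
    ([transports_normal_form]), and to no other one ([transports_family_uniq]). *)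

(** * Coordinates on strictly upper triangular matrices *)

#[local] Arguments basis_coord : simpl never.

(** Locked, so that the additivity rules for coordinates do not unfold it. *)
HB.lock Definition of_coords (K : fieldType) (a b c : K) : UT3 K :=
  a *: e12 K + b *: e23 K + c *: e13 K.

Section Coordinates.
Variable K : fieldType.
Implicit Types (u v : UT3 K) (s : basis_index).

Lemma UT3_eqP u v :
  basis_coord I12 u = basis_coord I12 v ->
  basis_coord I23 u = basis_coord I23 v ->
  basis_coord I13 u = basis_coord I13 v -> u = v.
Proof.
case: u v => [M HM] [N HN]; rewrite /basis_coord /= => h12 h23 h13.
apply: val_inj; apply/matrixP => /= i j.
have [le_ji|] := leqP j i.
  by rewrite (strict_upperP _ HM) // (strict_upperP _ HN).
have E k l (i' j' : 'I_3) : M k l = N k l -> k = i' -> l = j' -> M i' j' = N i' j'.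
  by move=> e <- <-.
by case: i j => [[|[|[|?]]] ?] [[|[|[|?]]] ?] //= _;
  [apply: E h12 _ _ | apply: E h13 _ _ | apply: E h23 _ _]; apply: val_inj.
Qed.

Lemma basis_coordD s u v :
  basis_coord s (u + v) = basis_coord s u + basis_coord s v.
Proof. by case: s; rewrite /basis_coord /= mxE. Qed.

Lemma basis_coordZ s (k : K) u : basis_coord s (k *: u) = k * basis_coord s u.
Proof. by case: s; rewrite /basis_coord /= mxE. Qed.

Lemma basis_coord0 s : basis_coord s (0 : UT3 K) = 0.
Proof. by case: s; rewrite /basis_coord /= mxE. Qed.

Lemma basis_coord_of_coords s (a b c : K) :
  basis_coord s (of_coords a b c) =
  match s with I12 => a | I23 => b | I13 => c end.
Proof.
rewrite of_coords.unlock !basis_coordD !basis_coordZ.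
rewrite (basis_coordE K s I12) (basis_coordE K s I23) (basis_coordE K s I13).
by case: s; ring.
Qed.

Lemma of_coordsK u :
  of_coords (basis_coord I12 u) (basis_coord I23 u) (basis_coord I13 u) = u.
Proof. by apply: UT3_eqP; rewrite basis_coord_of_coords. Qed.

Lemma of_coords_inj (a b c a' b' c' : K) :
  of_coords a b c = of_coords a' b' c' -> [/\ a = a', b = b' & c = c'].
Proof.
move=> e; have E s := congr1 (basis_coord s) e.
by split; [have := E I12 | have := E I23 | have := E I13];
  rewrite !basis_coord_of_coords.
Qed.

Lemma e12E : e12 K = of_coords 1 0 0.
Proof. by rewrite of_coords.unlock scale1r !scale0r !addr0. Qed.

Lemma e23E : e23 K = of_coords 0 1 0.
Proof. by rewrite of_coords.unlock scale1r !scale0r !addr0 add0r. Qed.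

Lemma e13E : e13 K = of_coords 0 0 1.
Proof. by rewrite of_coords.unlock scale1r !scale0r !add0r. Qed.

Definition basisE := (e12E, e23E, e13E).

Definition coordE :=
  (basis_coordD, basis_coordZ, basis_coord0, basis_coord_of_coords).

Lemma UT3_mulE u v :
  UT3_mul u v = of_coords 0 0 (basis_coord I12 u * basis_coord I23 v).
Proof.
have low (w : UT3 K) (i j : 'I_3) : (j <= i)%N -> UT3_val w i j = 0.
  by apply: (strict_upperP _ (valP w)).
have dotE (i j : 'I_3) : UT3_val (UT3_mul u v) i j =
    u i 0 * v 0 j + (u i 1 * v 1 j + u i 2 * v 2 j).
  rewrite /= mxE !big_ord_recl big_ord0 addr0.
  have -> : lift ord0 ord0 = 1 :> 'I_3 by apply: val_inj.
  by have -> : lift ord0 (lift ord0 ord0) = 2 :> 'I_3 by apply: val_inj.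
apply: UT3_eqP; rewrite coordE /basis_coord dotE.
- by rewrite (low u 0 0) // (low v 1 1) // (low v 2 1) //; ring.
- by rewrite (low u 1 0) // (low u 1 1) // (low v 2 2) //; ring.
- by rewrite (low u 0 0) // (low v 2 2) //; ring.
Qed.

Lemma linear_expand (f : UT3 K -> UT3 K) (f_lin : linear f) u :
  f u = basis_coord I12 u *: f (e12 K) + basis_coord I23 u *: f (e23 K)
        + basis_coord I13 u *: f (e13 K).
Proof.
have f0 : f 0 = 0.
  have h : f 0 = f 0 + f 0 by have := f_lin 1 0 0; rewrite !scale1r addr0.
  by apply: (addrI (f 0)); rewrite addr0 -h.
have fZ k v : f (k *: v) = k *: f v by have := f_lin k v 0; rewrite f0 !addr0.
have fD v w : f (v + w) = f v + f w by have := f_lin 1 v w; rewrite !scale1r.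
by rewrite -{1}[u]of_coordsK of_coords.unlock !fD !fZ.
Qed.

End Coordinates.

(** * Matching structures in coordinates *)

Section StandardStar.
Variable K : fieldType.
Implicit Types (u v w : UT3 K).

(** [pp] and [qq] are the coefficients of the linear form [lam] below; the other
    fields are the components along [e13] of the products of [x = e12] and
    [y = e23]. *)
Record star_params :=
  StarParams { pp : K; qq : K; xx : K; xy : K; yx : K; yy : K }.
Implicit Types c : star_params.

Definition lam c u := pp c * basis_coord I12 u + qq c * basis_coord I23 u.

Definition std_star c u v : UT3 K :=
  let x1 := basis_coord I12 u in let y1 := basis_coord I23 u in
  let x2 := basis_coord I12 v in let y2 := basis_coord I23 v in
  of_coords (x1 * lam c v) (lam c u * y2)
    (xx c * (x1 * x2) + xy c * (x1 * y2) + yx c * (y1 * x2) + yy c * (y1 * y2)).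

Lemma std_star_of_coords c (a b e a' b' e' : K) :
  std_star c (of_coords a b e) (of_coords a' b' e') =
  of_coords (a * (pp c * a' + qq c * b')) ((pp c * a + qq c * b) * b')
    (xx c * (a * a') + xy c * (a * b') + yx c * (b * a') + yy c * (b * b')).
Proof. by rewrite /std_star /lam !basis_coord_of_coords. Qed.

(** This encodes associativity of [std_star c]. The first equation makes [lam c]
    multiplicative; the others are the components along [e13] of the
    associativity law on [e12] and [e23]. *)
Definition compatible c :=
  [/\ pp c * qq c = 0, pp c * yx c = 0, pp c * yy c = 0,
      qq c * xx c = 0 & qq c * yx c = 0].

Lemma std_star_matching12 c :
  compatible c -> matching12_structure (@UT3_mul K) (std_star c).
Proof.
case: c => p q a b g h [/= pq pg ph qa qg].
split; last first.
- move=> u v w; rewrite !UT3_mulE /std_star /lam /= !coordE.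
  by apply: (f_equal3 (@of_coords K)); ring.
- move=> u v w; rewrite !UT3_mulE /std_star /lam /= !coordE.
  by apply: (f_equal3 (@of_coords K)); ring.
split; last first.
  move=> u v w; rewrite /std_star /lam /= !coordE.
  apply: (f_equal3 (@of_coords K)); [by ring: pq | by ring: pq |].
  set x1 := basis_coord I12 u; set y1 := basis_coord I23 u.
  set x2 := basis_coord I12 v; set y2 := basis_coord I23 v.
  set x3 := basis_coord I12 w; set y3 := basis_coord I23 w.
  apply/eqP; rewrite -subr_eq0; apply/eqP.
  (* The defect of associativity along e13 lies in the ideal generated by the
     compatibility monomials. *)
  transitivity ((q * a) * (x1 * (x2 * y3 - y2 * x3))
    + (p * g) * ((y1 * x2 - x1 * y2) * x3) + (q * g) * (y1 * (x2 * y3 - y2 * x3))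
    + (p * h) * ((y1 * x2 - x1 * y2) * y3)); first by ring.
  by rewrite qa pg qg ph !mul0r !addr0.
by split=> ? k u v; apply: UT3_eqP; rewrite /std_star /lam /= !coordE /=; ring.
Qed.

Section FromMatching.
Variable star : UT3 K -> UT3 K -> UT3 K.
Hypothesis star_matching : matching12_structure (@UT3_mul K) star.

Definition params_of : star_params :=
  StarParams (basis_coord I12 (star (e12 K) (e12 K)))
             (basis_coord I12 (star (e12 K) (e23 K)))
             (basis_coord I13 (star (e12 K) (e12 K)))
             (basis_coord I13 (star (e12 K) (e23 K)))
             (basis_coord I13 (star (e23 K) (e12 K)))
             (basis_coord I13 (star (e23 K) (e23 K))).

(** The law [(u . v) * w = u * (v . w)] kills [e13 = e12 . e23] on both sides,
    because [e23 . w = 0] and [w . e12 = 0] for every [w]. *)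
Lemma star_e13 u : star (e13 K) u = 0 /\ star u (e13 K) = 0.
Proof.
case: star_matching => [[[linl linr] _] assoc _].
have e13_mul : e13 K = UT3_mul (e12 K) (e23 K).
  by rewrite UT3_mulE !basisE !coordE mulr1.
have mul0 v w : basis_coord I12 v * basis_coord I23 w = 0 -> UT3_mul v w = 0.
  by move=> e; rewrite UT3_mulE e; apply: UT3_eqP; rewrite !coordE.
have star00 v : star 0 v = 0 /\ star v 0 = 0.
  by rewrite (linear_expand (linl v)) (linear_expand (linr v)) !basis_coord0
    !scale0r !addr0.
split; rewrite e13_mul.
- by rewrite assoc [UT3_mul _ _]mul0 ?(star00 _).2 // e23E coordE mul0r.
- by rewrite -assoc [UT3_mul _ _]mul0 ?(star00 _).1 // e12E coordE mulr0.
Qed.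

Lemma star_expand u v : star u v =
  basis_coord I12 u *: (basis_coord I12 v *: star (e12 K) (e12 K)
                      + basis_coord I23 v *: star (e12 K) (e23 K))
  + basis_coord I23 u *: (basis_coord I12 v *: star (e23 K) (e12 K)
                        + basis_coord I23 v *: star (e23 K) (e23 K)).
Proof.
case: star_matching => [[[linl linr] _] _ _].
rewrite (linear_expand (linl v)) (star_e13 _).1 scaler0 addr0.
by rewrite !(linear_expand (linr _) v) !(star_e13 _).2 !scaler0 !addr0.
Qed.

(** This is the law [(u * v) . w = u . (v * w)] read along [e13], the only direction
    in which a matrix product can be nonzero. *)
Lemma star_coord_balance u v w :
  basis_coord I12 (star u v) * basis_coord I23 w =
  basis_coord I12 u * basis_coord I23 (star v w).
Proof.
case: star_matching => _ _ /(_ u v w).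
by rewrite !UT3_mulE => /of_coords_inj[].
Qed.

(** Taking [u] and [w] among [e12], [e23] in [star_coord_balance] expresses
    the first two coordinates of all products through the linear form
    [v |-> basis_coord I12 (star e12 v) = basis_coord I23 (star v e23)]. *)
Lemma star_std u v : star u v = std_star params_of u v.
Proof.
have X1 w : basis_coord I12 (star (e23 K) w) = 0.
  have := star_coord_balance (e23 K) w (e23 K).
  by rewrite [X in _ * basis_coord I23 X = _]e23E [X in _ = basis_coord I12 X * _]e23E
    !coordE mulr1 mul0r.
have Y1 w : basis_coord I23 (star w (e12 K)) = 0.
  have := star_coord_balance (e12 K) w (e12 K).
  by rewrite [X in _ * basis_coord I23 X = _]e12E [X in _ = basis_coord I12 X * _]e12E
    !coordE mulr0 mul1r.
have Y2 w : basis_coord I23 (star w (e23 K)) = basis_coord I12 (star (e12 K) w).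
  have := star_coord_balance (e12 K) w (e23 K).
  by rewrite [X in _ * basis_coord I23 X = _]e23E [X in _ = basis_coord I12 X * _]e12E
    !coordE mulr1 mul1r.
by rewrite star_expand; apply: UT3_eqP;
  rewrite /std_star /lam /= !coordE /= ?X1 ?Y1 ?Y2; ring.
Qed.

Lemma params_of_compatible : compatible params_of.
Proof.
case: star_matching => [[_ assoc] _ _].
have std_assoc u v w : std_star params_of u (std_star params_of v w)
    = std_star params_of (std_star params_of u v) w.
  by rewrite -!star_std assoc.
move: params_of std_assoc => [p q a b g h] std_assoc.
have := std_assoc (e12 K) (e23 K) (e12 K); have := std_assoc (e12 K) (e23 K) (e23 K).
have := std_assoc (e23 K) (e12 K) (e12 K); have := std_assoc (e23 K) (e23 K) (e12 K).
rewrite !basisE !std_star_of_coords /=.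
rewrite !(mulr0, mul0r, mulr1, mul1r, addr0, add0r).
move=> /of_coords_inj[_ _ yyx] /of_coords_inj[_ _ yxx].
move=> /of_coords_inj[_ _ xyy] /of_coords_inj[xyx _ xyx'].
have pg : p * g = 0 by rewrite mulrC.
split=> //=; rewrite mulrC //.
- by move: xyy; rewrite -[LHS]addr0 => /addrI.
- by move: xyx'; rewrite [g * p]mulrC pg addr0.
Qed.

End FromMatching.

Definition family_params (f : UT3_family K) : star_params :=
  match f with
  | Fam1 => StarParams 1 0 0 0 0 0
  | Fam2 => StarParams 0 1 0 0 0 0
  | Fam3 alpha beta gamma => StarParams 0 0 alpha beta gamma 1
  | Fam4 alpha beta => StarParams 0 0 1 alpha beta 0
  | Fam5 alpha beta => StarParams 0 0 0 alpha beta 0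
  end.

Lemma family_starE f u v : family_star f u v = std_star (family_params f) u v.
Proof.
rewrite /family_star /table_product !big_cons !big_nil !addr0.
by case: f => *; rewrite /family_table ?basisE; apply: UT3_eqP;
  rewrite !basis_coordD !basis_coordZ !basis_coord0;
  rewrite /std_star !basis_coord_of_coords /lam /=;
  ring.
Qed.

Lemma family_params_compatible f : compatible (family_params f).
Proof. by case: f => *; split=> /=; ring. Qed.

Lemma eq_matching12 (star1 star2 : UT3 K -> UT3 K -> UT3 K) :
    (forall u v, star1 u v = star2 u v) ->
  matching12_structure (@UT3_mul K) star2 -> matching12_structure (@UT3_mul K) star1.
Proof.
move=> e [[[linl linr] assoc] ds sd]; split; first split; first split.
- by move=> v k x y; rewrite !e linl.
- by move=> v k x y; rewrite !e linr.
- by move=> x y z; rewrite !e assoc.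
- by move=> x y z; rewrite !e ds.
- by move=> x y z; rewrite !e sd.
Qed.

(** * Automorphisms and isomorphisms *)

Definition diag_map (a d s t : K) u : UT3 K :=
  of_coords (a * basis_coord I12 u) (d * basis_coord I23 u)
    (s * basis_coord I12 u + t * basis_coord I23 u + a * d * basis_coord I13 u).

Lemma diag_map_linear a d s t : linear (diag_map a d s t).
Proof. by move=> k u v; apply: UT3_eqP; rewrite /diag_map !coordE; ring. Qed.

HB.instance Definition _ a d s t :=
  GRing.isLinear.Build K (UT3 K) (UT3 K) _ (diag_map a d s t)
    (diag_map_linear a d s t).

(** The inverse is again a [diag_map]. *)
Lemma diag_map_automorphism a d s t : a != 0 -> d != 0 ->
  algebra_automorphism (@UT3_mul K) (diag_map a d s t).
Proof.
move=> a0 d0; split; last first.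
  move=> u v; rewrite /= !UT3_mulE /diag_map !coordE.
  by apply: (f_equal3 (@of_coords K)); ring.
exists (diag_map a^-1 d^-1 (- s / (a * a * d)) (- t / (a * d * d))) => u;
  apply: UT3_eqP; rewrite /diag_map !coordE; field; rewrite ?a0 ?d0 //.
Qed.

(** With [a], [b] and [c], [d] the first two coordinates of the images of [e12] and
    [e23], the vanishing squares of [e12] and [e23] give [a b = 0] and [c d = 0],
    while [e13 = e12 . e23] is sent to [a d e13], which injectivity makes nonzero.
    Hence [b = c = 0]. *)
Lemma automorphism_diag_map (phi : {linear UT3 K -> UT3 K}) :
    algebra_automorphism (@UT3_mul K) phi ->
  exists a d s t, [/\ a != 0, d != 0 & phi =1 diag_map a d s t].
Proof.
case=> /bij_inj phi_inj phiM.
have coordM s u v : basis_coord s (phi (UT3_mul u v)) =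
    if s is I13 then basis_coord I12 (phi u) * basis_coord I23 (phi v) else 0.
  by rewrite phiM UT3_mulE basis_coord_of_coords; case: s.
have xxE : UT3_mul (e12 K) (e12 K) = 0.
  by apply: UT3_eqP; rewrite UT3_mulE e12E !coordE ?mulr0.
have yyE : UT3_mul (e23 K) (e23 K) = 0.
  by apply: UT3_eqP; rewrite UT3_mulE e23E !coordE ?mul0r.
have xyE : UT3_mul (e12 K) (e23 K) = e13 K.
  by rewrite UT3_mulE !basisE !coordE mulr1.
set a := basis_coord I12 (phi (e12 K)); set d := basis_coord I23 (phi (e23 K)).
have phi_z : phi (e13 K) = of_coords 0 0 (a * d).
  by apply: UT3_eqP; rewrite -xyE coordM basis_coord_of_coords.
have ad_neq0 : a * d != 0.
  apply/eqP => ad0; have : e13 K = 0.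
    by apply: phi_inj; rewrite phi_z linear0 ad0; apply: UT3_eqP; rewrite !coordE.
  move/(congr1 (basis_coord I13)); rewrite e13E !coordE.
  by apply/eqP; rewrite oner_neq0.
have [a0 d0] : a != 0 /\ d != 0 by move: ad_neq0; rewrite mulf_eq0 negb_or => /andP.
have b0 : basis_coord I23 (phi (e12 K)) = 0.
  apply: (mulfI a0); rewrite mulr0.
  by have := coordM I13 (e12 K) (e12 K); rewrite xxE linear0 basis_coord0.
have c0 : basis_coord I12 (phi (e23 K)) = 0.
  apply: (mulIf d0); rewrite mul0r.
  by have := coordM I13 (e23 K) (e23 K); rewrite yyE linear0 basis_coord0.
exists a, d, (basis_coord I13 (phi (e12 K))), (basis_coord I13 (phi (e23 K))).
split=> // u; rewrite (linear_expand (f := phi)); last by move=> k v w; rewrite linearP.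
by rewrite phi_z; apply: UT3_eqP; rewrite /diag_map !coordE ?b0 ?c0 -/a -/d; ring.
Qed.

Lemma diag_map_of_coords (a d s t x y z : K) :
  diag_map a d s t (of_coords x y z) =
  of_coords (a * x) (d * y) (s * x + t * y + a * d * z).
Proof. by rewrite /diag_map !basis_coord_of_coords. Qed.

(** For nonzero [a] and [d], these equations say that [diag_map a d s t] carries
    [std_star c] to [std_star c'] on the products of [e12] and [e23]; the common
    factor [a], [d] or [a * d] has been cancelled in the equations for [pp], [qq]
    and [yx]. *)
Definition transports a d s t c c' :=
  [/\ pp c = pp c' * a, qq c = qq c' * d,
      s * pp c + a * d * xx c = xx c' * (a * a),
      s * qq c + t * pp c + a * d * xy c = xy c' * (a * d) &
      yx c = yx c' /\ t * qq c + a * d * yy c = yy c' * (d * d)].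

(** Since all automorphisms are known, isomorphism becomes solvability of an
    explicit system, and invariants can be read off its equations. *)
Lemma isomorphic_std star1 star2 c1 c2 :
    (forall u v, star1 u v = std_star c1 u v) ->
    (forall u v, star2 u v = std_star c2 u v) ->
  matching12_isomorphic (@UT3_mul K) star1 star2 <->
  exists a d s t, [/\ a != 0, d != 0 & transports a d s t c1 c2].
Proof.
move=> star1E star2E; split.
  case=> phi /automorphism_diag_map[a [d [s [t [a0 d0 phiE]]]]] phi_star.
  have E u v : diag_map a d s t (std_star c1 u v)
      = std_star c2 (diag_map a d s t u) (diag_map a d s t v).
    by rewrite -!phiE -star1E -star2E.
  exists a, d, s, t; split=> //.
  have := E (e12 K) (e12 K); have := E (e12 K) (e23 K).
  have := E (e23 K) (e12 K); have := E (e23 K) (e23 K).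
  rewrite !basisE !(diag_map_of_coords, std_star_of_coords).
  rewrite !(mulr0, mul0r, mulr1, mul1r, addr0, add0r).
  move=> /of_coords_inj[_ _ eyy] /of_coords_inj[_ _ eyx].
  move=> /of_coords_inj[/(mulfI a0) eqq _ exy] /of_coords_inj[/(mulfI a0) ep _ exx].
  split=> //; split=> //.
  by apply: (mulfI (mulf_neq0 a0 d0)); rewrite eyx; ring.
case=> a [d [s [t [a0 d0 [ep eqq exx exy [eyx eyy]]]]]].
exists (diag_map a d s t); first exact: diag_map_automorphism.
move=> u v; rewrite /= star1E star2E -[u]of_coordsK -[v]of_coordsK.
rewrite !(diag_map_of_coords, std_star_of_coords).
set x1 := basis_coord I12 u; set y1 := basis_coord I23 u.
set x2 := basis_coord I12 v; set y2 := basis_coord I23 v.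
apply: (f_equal3 (@of_coords K)); [by rewrite ep eqq; ring | by rewrite ep eqq; ring |].
transitivity ((s * pp c1 + a * d * xx c1) * (x1 * x2)
  + (s * qq c1 + t * pp c1 + a * d * xy c1) * (x1 * y2)
  + a * d * yx c1 * (y1 * x2) + (t * qq c1 + a * d * yy c1) * (y1 * y2)).
  by ring.
by rewrite exx exy eyx eyy; ring.
Qed.

(** * The normal form *)

(** In the third case [xx] and [yy] are scaled by reciprocal factors, so that [yy]
    becomes 1 and [xx] becomes the invariant product of the two. *)
Definition normal_form c : UT3_family K :=
  if pp c != 0 then Fam1 K else
  if qq c != 0 then Fam2 K else
  if yy c != 0 then Fam3 (xx c * yy c) (xy c) (yx c) else
  if xx c != 0 then Fam4 (xy c) (yx c) else Fam5 (xy c) (yx c).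

Lemma transports_normal_form c : compatible c ->
  exists a d s t,
    [/\ a != 0, d != 0 & transports a d s t c (family_params (normal_form c))].
Proof.
case: c => p q a b g h [/= pq pg ph qa qg].
have z0 (k m : K) : k * m = 0 -> k != 0 -> m = 0.
  by move=> /eqP; rewrite mulf_eq0 => /orP[] /eqP // ->; rewrite eqxx.
rewrite /normal_form /transports /=.
have [->|p0] := eqVneq p 0; last first.
  rewrite (z0 _ _ pq p0) (z0 _ _ pg p0) (z0 _ _ ph p0) /=.
  (* [s] and [t] cancel the components of e12 * e12 and e12 * e23 along e13. *)
  by exists p, 1, (- a), (- b); do !split; rewrite ?oner_neq0 //; ring.
have [->|q0] := eqVneq q 0; last first.
  rewrite (z0 _ _ qa q0) (z0 _ _ qg q0) /=.
  by exists 1, q, (- b), (- h); do !split; rewrite ?oner_neq0 //; ring.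
have [->|h0] := eqVneq h 0; last first.
  by exists 1, h, 0, 0; do !split; rewrite ?oner_neq0 //=; ring.
have [->|a0] := eqVneq a 0; last first.
  by exists a, 1, 0, 0; do !split; rewrite ?oner_neq0 //=; ring.
by exists 1, 1, 0, 0; do !split; rewrite ?oner_neq0 //=; ring.
Qed.

(** Each equation of [transports] shows an ingredient of [normal_form] to be
    preserved: [pp] and [qq] up to a nonzero factor, and, when both vanish, [xy],
    [yx], the product [xx * yy], and [xx] and [yy] up to nonzero factors. *)
Lemma transports_family_uniq c f a d s t : a != 0 -> d != 0 ->
  transports a d s t c (family_params f) -> f = normal_form c.
Proof.
move=> a0 d0; case: c => p q x b g h.
have ad0 := mulf_neq0 a0 d0.
case: f => [||al be ga|al be|al be] [/= -> -> exx exy [eyx eyy]];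
  rewrite /normal_form /= ?mul0r ?eqxx ?mul1r ?a0 ?d0 //=;
  move: exx exy eyy; rewrite !mul0r !mulr0 ?add0r ?mul1r [_ * (a * d)]mulrC.
- move=> exx /(mulfI ad0) <-; rewrite -mulrA eyx [a * (d * h)]mulrCA => /(mulfI d0) ah.
  have h0 : h != 0 by apply: contraNneq d0 => h0; rewrite -ah h0 mulr0.
  rewrite h0; congr Fam3.
  by apply: (mulIf (mulf_neq0 a0 a0)); rewrite -exx -ah; ring.
- move=> exx /(mulfI ad0) <- /eqP; rewrite mulf_eq0 (negPf ad0) /= => /eqP->.
  rewrite eqxx /= eyx; suff -> : x != 0 by [].
  by apply: contraNneq (mulf_neq0 a0 a0) => x0; rewrite -exx x0 mulr0.
- move=> /eqP; rewrite mulf_eq0 (negPf ad0) /= => /eqP->.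
  move=> /(mulfI ad0) <- /eqP; rewrite mulf_eq0 (negPf ad0) /= => /eqP->.
  by rewrite eqxx eyx.
Qed.

End StandardStar.

Theorem proposition3p23 (K : fieldType) :
  (forall f : UT3_family K, matching12_structure (@UT3_mul K) (family_star f)) /\
  (forall star : UT3 K -> UT3 K -> UT3 K,
     matching12_structure (@UT3_mul K) star ->
     exists! f : UT3_family K,
       matching12_isomorphic (@UT3_mul K) star (family_star f)).
Proof.
split=> [f | star star_matching].
  apply: eq_matching12 (family_starE f) _.
  exact/std_star_matching12/family_params_compatible.
have isoE f := isomorphic_std (star_std star_matching) (family_starE f).
exists (normal_form (params_of star)); split.
  exact/isoE/transports_normal_form/params_of_compatible.
by move=> f /isoE[a [d [s [t [a0 d0]]]]] /(transports_family_uniq a0 d0).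
Qed.
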